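(* Let $K$ and $E$ be finite-dimensional associative unital algebras over $\mathbb{C}$, with dual coalgebras $L=K^*$ and $F=E^*$, let $x: L\to \mathrm{Invd}(F)$ be a linear map, $y=x^t:F\to \mathrm{Invd}(L)$ its transpose, and $\pi_x:T(L)\to \mathrm{Invd}(T(F))$ the algebra morphism associated with $x$, whose image is $U_x$. For an integer $m\ge 0$ let $R_m(U_x)=T_m(L)\cap \ker\pi_x$, let $B_m\subset T_m(K)$ be the orthogonal of $R_m(U_x)$ in the dual $T_m(K)$ of $T_m(L)$, and let $B^m$ be the subalgebra of $T_m(K)$ generated by the unit of $T_m(K)$ and the subspace $Y^m_{t,op}(F)$, where for $f\in F$ $$Y^m_{t,op}(f)=\sum_{n=0}^m \otimes^n y_t\circ\Delta_{F,op}^{n-1}(f)\in T_m(K),$$ the term for $n=0$ being $\epsilon_F(f)\in\mathbb{C}$. Then the orthogonal of $B^m$ in $T_m(L)$ is the space of relations of order $m$, $R_m(U_x)$; and hence $B_m=B^m$ for all $m$.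
   Context: All coalgebras are coassociative with counit, over $\mathbb{C}$. For a coalgebra $C$, $\mathrm{Invd}(C)$ denotes the algebra of right-invariant operators, i.e. the $A\in \mathrm{End}(C)$ with $\Delta_C\circ A=(A\otimes \mathrm{id})\circ\Delta_C$. For $A\in \mathrm{Invd}(C)$ and $c\in C$ put $\langle A,c\rangle=\epsilon_C(A(c))$; the map $A\mapsto \epsilon_C\circ A$ is a linear isomorphism $\mathrm{Invd}(C)\to C^*$. The transpose $y=x^t:F\to \mathrm{Invd}(L)$ of $x$ is the linear map determined by $\langle y(f),l\rangle=\langle x(l),f\rangle$ for all $l\in L$, $f\in F$. The linear map $y_t:F\to K$ is defined by requiring that $y(f)$ be the transpose of the operator of left multiplication by $y_t(f)$ on $K$; equivalently $l(y_t(f))=\langle y(f),l\rangle$ for all $l\in L=K^*$. $\Delta_{F,op}$ is the opposite coproduct of $F$, $\Delta_{F,op}^{n-1}:F\to\otimes^nF$ is its $(n-1)$-fold iterate (identity for $n=1$). The tensor algebra $T(L)=\mathbb{C}\oplus L\oplus (L\otimes L)\oplus\cdots$ is a bialgebra whose coproduct $\Delta_L$ and counit $\epsilon_L$ are the unique unital algebra morphisms extending those of $L$; similarly $T(F)$ with $\Delta_F,\epsilon_F$. $T_m(L)=\mathbb{C}\oplus L\oplus\cdots\oplus\otimes^mL$ is a subcoalgebra of $T(L)$. $T_m(K)=\mathbb{C}\oplus K\oplus\cdots\oplus\otimes^mK$ is considered as the dual of $T_m(L)$ (pairing $\otimes^iK$ with $\otimes^iL$ factor by factor, and $\otimes^iK$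 with $\otimes^jL$ to zero for $i\neq j$), with the algebra structure dual to the coalgebra structure of $T_m(L)$; that is, $T_m(K)$ is the direct product of the algebras $\otimes^iK$, $0\le i\le m$ (with $\otimes^0K=\mathbb{C}$), each with its tensor product algebra structure. This is not the (truncated) tensor algebra multiplication. Orthogonals are taken with respect to this pairing. For $l\in L$, the operator $X(l)$ on $T(F)$ is determined by: $X(l)(1)=\epsilon_L(l)1$; $X(l)(f)=x(l)(f)$ for $f\in F$; and $X(l)(w_1w_2)=\sum_k X(l_k')(w_1)\,X(l_k'')(w_2)$ for $w_1,w_2\in T(F)$, where $\Delta_L(l)=\sum_k l_k'\otimes l_k''$. It is known that $X(l)\in \mathrm{Invd}(T(F))$. The map $\pi_x:T(L)\to \mathrm{Invd}(T(F))\subset \mathrm{End}(T(F))$ is the unital algebra morphism (product in the target is composition) with $\pi_x(l)=X(l)$ for $l\in L$. *)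

(* Defs.v *)
From HB Require Import structures.
From mathcomp Require Import all_boot all_order all_algebra falgebra finmap.
From mathcomp.multinomials Require Import monalg.
From mathcomp Require Import classical_sets reals complex.

Set Implicit Arguments.
Unset Strict Implicit.
Unset Printing Implicit Defensive.

Import GRing.Theory.
Local Open Scope classical_set_scope.
Local Open Scope ring_scope.

Notation dual V := 'Hom(V, _^o).

(* T(V), for V of finite dimension, is the free algebra on letters indexed like
   the basis [vbasis fullv] of V: the word i_1 ... i_n stands for the tensor
   b_(i_1) (x) ... (x) b_(i_n), the words of length n span the n-th tensor power
   of V, and the ring product is concatenation. The product is locked because
   unifying two products in a concrete monoid algebra does not terminate in
   reasonable time. *)
Definition tensor (C : fieldType) (V : vectType C) :=
  {malg C[{fmonom 'I_(\dim {:V})}]}.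

HB.lock Definition tensor_mul (C : fieldType) (V : vectType C) (u v : tensor V) :
  tensor V := (u : {malg C[{fmonom 'I_(\dim {:V})}]}) * v.

Section TensorAlgebra.
Variables (C : fieldType) (V : vectType C).
Notation MA := {malg C[{fmonom 'I_(\dim {:V})}]}.

HB.instance Definition _ := GRing.Lmodule.copy (tensor V) MA.

Let one : tensor V := (1 : MA).

Fact tensor_mulA : associative (@tensor_mul C V).
Proof. by move=> u v w; rewrite !tensor_mul.unlock; apply: (@mulrA MA). Qed.

Fact tensor_1mul : left_id one (@tensor_mul C V).
Proof. by move=> u; rewrite tensor_mul.unlock; apply: (@mul1r MA). Qed.

Fact tensor_mul1 : right_id one (@tensor_mul C V).
Proof. by move=> u; rewrite tensor_mul.unlock; apply: (@mulr1 MA). Qed.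

Fact tensor_mulDl : left_distributive (@tensor_mul C V) +%R.
Proof. by move=> u v w; rewrite !tensor_mul.unlock; apply: (@mulrDl MA). Qed.

Fact tensor_mulDr : right_distributive (@tensor_mul C V) +%R.
Proof. by move=> u v w; rewrite !tensor_mul.unlock; apply: (@mulrDr MA). Qed.

Fact tensor_oner_neq0 : one != 0.
Proof. exact: (oner_neq0 MA). Qed.

HB.instance Definition _ := GRing.Zmodule_isNzRing.Build (tensor V)
  tensor_mulA tensor_1mul tensor_mul1 tensor_mulDl tensor_mulDr tensor_oner_neq0.

Lemma tensorM (u v : tensor V) : u * v = (u : MA) * v :> MA.
Proof. by rewrite -[LHS]/(tensor_mul u v) tensor_mul.unlock. Qed.

Fact tensor_scalerAl (a : C) (u v : tensor V) :
  a *: tensor_mul u v = tensor_mul (a *: u) v.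
Proof. by rewrite !tensor_mul.unlock; apply: (@scalerAl _ MA). Qed.

HB.instance Definition _ :=
  GRing.Lmodule_isLalgebra.Build C (tensor V) tensor_scalerAl.

Fact tensor_scalerAr (a : C) (u v : tensor V) :
  a *: tensor_mul u v = tensor_mul u (a *: v).
Proof.
rewrite !tensor_mul.unlock; apply/malgP => k.
rewrite mcoeffZ [RHS](mcoeffMlw k (fsubset_refl (msupp u)) (msuppZ_le a v)).
rewrite mcoeffMl mulr_sumr; apply: eq_bigr => i _.
rewrite mulr_sumr; apply: eq_bigr => j _.
by rewrite mcoeffZ mulrnAr !mulrA [a * _]mulrC.
Qed.

HB.instance Definition _ :=
  GRing.Lalgebra_isAlgebra.Build C (tensor V) tensor_scalerAr.

End TensorAlgebra.

Section Words.
Variables (C : fieldType) (V : vectType C).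

Definition tbasis (i : 'I_(\dim {:V})) : V := tnth (vbasis {:V}) i.

Definition tword (s : seq 'I_(\dim {:V})) : tensor V := << FMonom s >>.

End Words.

(* The inclusion of V in T(V). *)
HB.lock Definition tin (C : fieldType) (V : vectType C) (v : V) : tensor V :=
  \sum_i coord (vbasis {:V}) i v *: tword [:: i].
Arguments tin {C V} v.

(* Linear extension of a function given on words. *)
HB.lock Definition tlin (C : fieldType) (V : vectType C) (W : lmodType C)
    (h : seq 'I_(\dim {:V}) -> W) (t : tensor V) : W :=
  \sum_(k <- msupp t) t@_k *: h k.
Arguments tlin {C V W} h t.

Section TensorMaps.
Variables (C : fieldType) (V : vectType C).

(* For a linear g, the algebra morphism extending g: see [tlift_in], [tliftM]
   and [tlift_unique]. *)
Definition tlift (A : algType C) (g : V -> A) : tensor V -> A :=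
  tlin (fun s => \prod_(i <- s) g (tbasis i)).

(* T_m(V) *)
Definition tdeg_le (m : nat) : set (tensor V) :=
  [set t | forall k, k \in msupp t -> (fdeg k <= m)%N].

End TensorMaps.

Section TensorTheory.
Variables (C : fieldType) (V : vectType C).
Notation TV := (tensor V).

Lemma tbasisE (v : V) : v = \sum_i coord (vbasis {:V}) i v *: tbasis i.
Proof.
rewrite {1}(coord_vbasis (memvf v)); apply: eq_bigr => i _.
by rewrite /tbasis (tnth_nth 0).
Qed.

Lemma coord_tbasis i j : coord (vbasis {:V}) i (tbasis j) = (j == i)%:R.
Proof.
by rewrite /tbasis (tnth_nth 0) coord_free // (basis_free (vbasisP _)).
Qed.

Lemma tin_is_linear : linear (@tin C V).
Proof.
move=> a u v; rewrite tin.unlock scaler_sumr -big_split; apply: eq_bigr => i _ /=.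
by rewrite linearP scalerDl scalerA.
Qed.

HB.instance Definition _ := GRing.isLinear.Build C V TV _ (@tin C V) tin_is_linear.

Lemma tin_tbasis i : tin (tbasis i) = tword [:: i] :> TV.
Proof.
rewrite tin.unlock (bigD1 i) //= coord_tbasis eqxx scale1r big1 ?addr0 // => j ji.
by rewrite coord_tbasis eq_sym (negPf ji) scale0r.
Qed.

Lemma tword_cons i (s : seq 'I_(\dim {:V})) :
  tword (i :: s) = tword [:: i] * tword s.
Proof.
rewrite tensorM /tword malgM_def fgmulUU mulr1; congr (<< _ >>).
by apply/eqP; rewrite fmP fmM.
Qed.

Lemma tword_nil : tword [::] = 1 :> TV.
Proof. by congr (<< _ >>); apply/eqP; rewrite fmP fm1. Qed.

Section Lin.
Variables (W : lmodType C) (h : seq 'I_(\dim {:V}) -> W).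

Lemma tlinEw (d : {fset {fmonom 'I_(\dim {:V})}}) (t : TV) :
  (msupp t `<=` d)%fset -> tlin h t = \sum_(k <- d) t@_k *: h k.
Proof.
move=> le; rewrite tlin.unlock (big_fset_incl _ le) //= => k _ /mcoeff_outdom ->.
by rewrite scale0r.
Qed.

Lemma tlin_is_linear : linear (tlin h).
Proof.
move=> a u v.
pose d := (msupp u `|` msupp v `|` msupp (a *: u + v))%fset.
rewrite !(@tlinEw d) ?/d ?fsubsetUr //; last 2 first.
- by rewrite -fsetUA fsetUCA fsubsetUl.
- by rewrite -fsetUA fsubsetUl.
rewrite scaler_sumr -big_split; apply: eq_bigr => k _ /=.
by rewrite mcoeffD mcoeffZ scalerDl scalerA.
Qed.

HB.instance Definition _ := GRing.isLinear.Build C TV W _ (tlin h) tlin_is_linear.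

Lemma tlin_word s : tlin h (tword s) = h s.
Proof.
by rewrite (tlinEw msuppU_le) big_seq_fset1 mcoeffUU scale1r.
Qed.

Lemma tlin1 : tlin h 1 = h [::].
Proof. by rewrite -tword_nil tlin_word. Qed.
End Lin.

Lemma eq_tlin (W : lmodType C) (h1 h2 : seq 'I_(\dim {:V}) -> W) :
  h1 =1 h2 -> tlin h1 =1 tlin h2.
Proof. by move=> e t; rewrite tlin.unlock; apply: eq_bigr => k _; rewrite e. Qed.

Lemma tensor_word_ind (P : TV -> Prop) :
    P 0 -> (forall a u v, P u -> P v -> P (a *: u + v)) ->
  (forall s, P (tword s)) -> forall t, P t.
Proof.
move=> P0 Plin Pk t; rewrite [t]monalgE.
elim: (X in \sum_(_ <- X) _) => [|k r IHr]; first by rewrite big_nil.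
rewrite big_cons.
suff -> : << t@_k *g k >> = t@_k *: tword k :> TV by apply: Plin.
apply/malgP => k'; rewrite mcoeffZ !mcoeffU mulrnAr mulr1.
by case: k.
Qed.

Lemma tensor_ind (P : TV -> Prop) :
    P 0 -> (forall a u v, P u -> P v -> P (a *: u + v)) ->
  P 1 -> (forall v t, P t -> P (tin v * t)) -> forall t, P t.
Proof.
move=> P0 Plin P1 Pv; apply: tensor_word_ind => //.
elim=> [|i s IHs]; first by rewrite tword_nil.
by rewrite tword_cons -tin_tbasis; apply: Pv.
Qed.

Lemma tlin_tinM (W : lmodType C) (h : seq 'I_(\dim {:V}) -> W) v (t : TV) :
  tlin h (tin v * t) =
  \sum_i coord (vbasis {:V}) i v *: tlin (fun s => h (i :: s)) t.
Proof.
rewrite tin.unlock mulr_suml linear_sum; apply: eq_bigr => i _.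
rewrite -scalerAl linearZ /=; congr (_ *: _).
elim/tensor_word_ind: t => [|a u w IHu IHw|s].
- by rewrite mulr0 !linear0.
- by rewrite mulrDr -scalerAr !tlin_is_linear IHu IHw.
- by rewrite -tword_cons !tlin_word.
Qed.

Section Lift.
Variables (A : algType C) (g : V -> A).

Lemma tlift1 : tlift g 1 = 1.
Proof. by rewrite /tlift tlin1 big_nil. Qed.

Lemma tlift_is_linear : linear (tlift g).
Proof. exact: tlin_is_linear. Qed.

HB.instance Definition _ :=
  GRing.isLinear.Build C TV A _ (tlift g) tlift_is_linear.

Hypothesis g_lin : linear g.

Lemma tlift_tinM v t : tlift g (tin v * t) = g v * tlift g t.
Proof.
pose g' : {linear V -> A} := HB.pack g (GRing.isLinear.Build C V A _ g g_lin).
rewrite /tlift tlin_tinM {2}[v]tbasisE -[g]/(g' : V -> A) linear_sum mulr_suml.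
apply: eq_bigr => i _; rewrite linearZ /= -scalerAl; congr (_ *: _).
elim/tensor_word_ind: t => [|a u w IHu IHw|s].
- by rewrite !linear0 mulr0.
- by rewrite !tlin_is_linear IHu IHw mulrDr -scalerAr.
- by rewrite !tlin_word big_cons.
Qed.

Lemma tliftM u v : tlift g (u * v) = tlift g u * tlift g v.
Proof.
elim/tensor_ind: u => [|a u w IHu IHw||w t IHt].
- by rewrite !(mul0r, linear0).
- by rewrite mulrDl -scalerAl !tlift_is_linear IHu IHw mulrDl -scalerAl.
- by rewrite tlift1 !mul1r.
- by rewrite -mulrA !tlift_tinM IHt mulrA.
Qed.

Lemma tlift_in v : tlift g (tin v) = g v.
Proof. by rewrite -[tin v]mulr1 tlift_tinM tlift1 mulr1. Qed.

Lemma tlift_unique (f : TV -> A) : linear f -> f 1 = 1 ->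
    (forall u v, f (u * v) = f u * f v) -> (forall v, f (tin v) = g v) ->
  f =1 tlift g.
Proof.
move=> f_lin f1 fM f_in.
pose f' : {linear TV -> A} := HB.pack f (GRing.isLinear.Build C TV A _ f f_lin).
elim/tensor_ind => [|a u w IHu IHw||w t IHt].
- by rewrite -[f]/(f' : TV -> A) !linear0.
- by rewrite f_lin IHu IHw tlift_is_linear.
- by rewrite f1 tlift1.
- by rewrite fM f_in IHt tlift_tinM.
Qed.
End Lift.
End TensorTheory.

(* The bilinear map T(V) x T(W) -> A sending (v_1 ... v_n, w_1 ... w_n) to
   phi v_1 w_1 * ... * phi v_n w_n and vanishing on pairs of words of different
   lengths: see [tzip_prod]. *)
Definition tzip (C : fieldType) (V W : vectType C) (A : algType C)
    (phi : V -> W -> A) (u : tensor V) (w : tensor W) : A :=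
  tlin (fun s => tlin (fun t =>
    if size s == size t then
      \prod_(p <- zip s t) phi (tbasis p.1) (tbasis p.2)
    else 0) w) u.

Section Zip.
Variables (C : fieldType) (V W : vectType C) (A : algType C).
Variable phi : V -> W -> A.

Lemma tzip_is_linearl w : linear (tzip phi ^~ w).
Proof. exact: tlin_is_linear. Qed.

Lemma tzip_is_linearr u : linear (tzip phi u).
Proof.
move=> a w1 w2; elim/tensor_word_ind: u => [|b u v IHu IHv|s].
- by rewrite /tzip !linear0 addr0.
- rewrite !tzip_is_linearl IHu IHv !scalerDr !scalerA [b * a]mulrC -!addrA.
  by congr (_ + _); rewrite addrCA.
- by rewrite /tzip !tlin_word tlin_is_linear.
Qed.

Hypothesis phi_linl : forall w, linear (phi ^~ w).
Hypothesis phi_linr : forall v, linear (phi v).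

Lemma tzip11 : tzip phi 1 1 = 1.
Proof. by rewrite /tzip !tlin1 eqxx big_nil. Qed.

Lemma tzip1_tin w t : tzip phi 1 (tin w * t) = 0.
Proof.
rewrite /tzip tlin1 tlin_tinM big1 // => i _.
elim/tensor_word_ind: t => [|a u v IHu IHv|s].
- by rewrite linear0 scaler0.
- by rewrite tlin_is_linear scalerDr IHv addr0 scalerA mulrC -scalerA IHu scaler0.
- by rewrite tlin_word scaler0.
Qed.

Lemma tzip_tin1 v t : tzip phi (tin v * t) 1 = 0.
Proof.
rewrite /tzip tlin_tinM big1 // => i _.
elim/tensor_word_ind: t => [|a u w IHu IHw|s].
- by rewrite linear0 scaler0.
- by rewrite tlin_is_linear scalerDr IHw addr0 scalerA mulrC -scalerA IHu scaler0.
- by rewrite tlin_word tlin1 scaler0.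
Qed.

Lemma tzip_tinM v w t u :
  tzip phi (tin v * t) (tin w * u) = phi v w * tzip phi t u.
Proof.
pose pl w : {linear V -> A} :=
  HB.pack (phi ^~ w) (GRing.isLinear.Build C V A _ (phi ^~ w) (phi_linl w)).
pose pr v : {linear W -> A} :=
  HB.pack (phi v) (GRing.isLinear.Build C W A _ (phi v) (phi_linr v)).
rewrite {1}/tzip tlin_tinM {2}[v]tbasisE -[phi _ w]/(pl w _) linear_sum.
rewrite mulr_suml; apply: eq_bigr => i _; rewrite linearZ /= -scalerAl.
congr (_ *: _); rewrite {2}[w]tbasisE -[phi _ _]/(pr _ _) linear_sum mulr_suml.
elim/tensor_word_ind: t => [|a t1 t2 IH1 IH2|s].
- rewrite linear0 big1 // => j _.
  by rewrite /tzip linear0 mulr0.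
- rewrite tlin_is_linear IH1 IH2 scaler_sumr -big_split; apply: eq_bigr => j _.
  by rewrite tzip_is_linearl mulrDr -scalerAr.
rewrite tlin_word tlin_tinM; apply: eq_bigr => j _.
rewrite linearZ /= -scalerAl; congr (_ *: _).
rewrite /tzip tlin_word.
elim/tensor_word_ind: u => [|a t1 t2 IH1 IH2|r].
- by rewrite !linear0 mulr0.
- by rewrite !tlin_is_linear IH1 IH2 mulrDr -scalerAr.
rewrite !tlin_word /= eqSS; case: eqP => _; last by rewrite mulr0.
by rewrite big_cons.
Qed.

Lemma tzip_prod (vs : seq V) (ws : seq W) :
  tzip phi (\prod_(v <- vs) tin v) (\prod_(w <- ws) tin w) =
  if size vs == size ws then \prod_(p <- zip vs ws) phi p.1 p.2 else 0.
Proof.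
elim: vs ws => [|v vs IHv] [|w ws]; rewrite ?big_nil ?big_cons /=.
- by rewrite tzip11.
- by rewrite tzip1_tin.
- by rewrite tzip_tin1.
- by rewrite tzip_tinM IHv eqSS; case: eqP; rewrite ?mulr0 // big_cons.
Qed.
End Zip.

Section DualCoalgebra.
Variables (C : fieldType) (A : falgType C).

Definition counit (l : dual A) : C := l 1.

Definition dual_basis (i : 'I_(\dim {:A})) : dual A :=
  linfun (coord (vbasis {:A}) i : A -> C^o).

(* The coproduct of A^*, dual to the product of A (see [coprodE]), as a list of
   pairs (l', l''): l = \sum l'_k (x) l''_k. *)
Definition coprod (l : dual A) : seq (dual A * dual A) :=
  [seq (dual_basis i, (l \o amull (tbasis i))%VF) | i <- enum 'I_(\dim {:A})].

Lemma coprodE l a b : \sum_(p <- coprod l) p.1 a * p.2 b = l (a * b).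
Proof.
rewrite big_map big_enum /= {2}[a]tbasisE mulr_suml linear_sum.
apply: eq_bigr => i _.
by rewrite -scalerAl linearZ !lfunE /= lfunE /=.
Qed.

(* Right-invariant operators: \Delta \o f = (f (x) id) \o \Delta, an equality
   in A^* (x) A^*, the space of words of length 2 in T(A^* ). *)
Definition invd (f : dual A -> dual A) : Prop :=
  forall l, \sum_(p <- coprod (f l)) tin p.1 * tin p.2 =
            \sum_(p <- coprod l) tin (f p.1) * tin p.2.

(* <f, l> *)
Definition ipair (f : dual A -> dual A) (l : dual A) : C := counit (f l).

Lemma dual_basisE (l : dual A) : l = \sum_i l (tbasis i) *: dual_basis i.
Proof.
apply/lfunP => a; rewrite sum_lfunE {1}[a]tbasisE linear_sum.
apply: eq_bigr => i _; rewrite linearZ !lfunE /=.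
by rewrite lfunE [LHS]mulrC.
Qed.

Lemma big_coprod (W : zmodType) (G : dual A -> dual A -> W) l :
  \sum_(p <- coprod l) G p.1 p.2 =
  \sum_i G (dual_basis i) (l \o amull (tbasis i))%VF.
Proof. by rewrite big_map big_enum. Qed.

Lemma comp_amullE (l : dual A) a b : (l \o amull a)%VF b = l (a * b).
Proof. by rewrite !lfunE /= lfunE. Qed.

Lemma coprod_bilin (W : lmodType C) (G : dual A -> dual A -> W) :
    (forall l', linear (G l')) -> forall l,
  \sum_(p <- coprod l) G p.1 p.2 =
  \sum_i \sum_j l (tbasis i * tbasis j) *: G (dual_basis i) (dual_basis j).
Proof.
move=> G_lin l; rewrite (big_coprod G); apply: eq_bigr => i _.
pose g : {linear dual A -> W} := HB.pack (G (dual_basis i))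
  (GRing.isLinear.Build C (dual A) W _ (G (dual_basis i)) (G_lin _)).
rewrite -[LHS]/(g _) [(l \o _)%VF]dual_basisE linear_sum.
by apply: eq_bigr => j _; rewrite linearZ /= comp_amullE.
Qed.

Lemma coprod_counitl l : \sum_(p <- coprod l) counit p.1 *: p.2 = l.
Proof.
apply/lfunP => a; rewrite sum_lfunE -[in RHS](mul1r a) -coprodE.
by apply: eq_bigr => p _; rewrite lfunE.
Qed.

Lemma coprod_counitr l : \sum_(p <- coprod l) counit p.2 *: p.1 = l.
Proof.
apply/lfunP => a; rewrite sum_lfunE -[in RHS](mulr1 a) -coprodE.
by apply: eq_bigr => p _; rewrite lfunE /= mulrC.
Qed.

Lemma coprod_linear (W : lmodType C) (G : dual A -> dual A -> W) :
    (forall l', linear (G l')) ->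
  linear (fun l => \sum_(p <- coprod l) G p.1 p.2).
Proof.
move=> G_lin a l1 l2; rewrite !(coprod_bilin G_lin) scaler_sumr -big_split.
apply: eq_bigr => i _; rewrite scaler_sumr -big_split; apply: eq_bigr => j _ /=.
by rewrite !lfunE /= lfunE scalerDl scalerA.
Qed.

Lemma coprod_coassoc (W : lmodType C) (G : dual A -> dual A -> dual A -> W) :
    (forall l1 l3, linear (fun l2 => G l1 l2 l3)) ->
    (forall l1 l2, linear (G l1 l2)) -> forall l,
  \sum_(p <- coprod l) \sum_(q <- coprod p.2) G p.1 q.1 q.2 =
  \sum_(p <- coprod l) \sum_(q <- coprod p.1) G q.1 q.2 p.2.
Proof.
move=> G2 G3 l.
rewrite (big_coprod (fun l1 l2 => \sum_(q <- coprod l2) G l1 q.1 q.2)).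
rewrite (big_coprod (fun l1 l2 => \sum_(q <- coprod l1) G q.1 q.2 l2)).
under [RHS]eq_bigr => k _ do
  rewrite (big_coprod (fun l1 l2 => G l1 l2 (l \o amull (tbasis k))%VF)).
rewrite exchange_big; apply: eq_bigr => i _ /=.
rewrite (big_coprod (fun l1 l2 => G (dual_basis i) l1 l2)).
pose g2 l3 : {linear dual A -> W} := HB.pack (fun l2 => G (dual_basis i) l2 l3)
  (GRing.isLinear.Build C (dual A) W _ _ (G2 (dual_basis i) l3)).
pose g3 l2 : {linear dual A -> W} := HB.pack (G (dual_basis i) l2)
  (GRing.isLinear.Build C (dual A) W _ _ (G3 (dual_basis i) l2)).
have e2 (l2 l3 : dual A) : G (dual_basis i) l2 l3 =
    \sum_j l2 (tbasis j) *: G (dual_basis i) (dual_basis j) l3.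
  rewrite -[LHS]/(g2 l3 l2) [l2 in LHS]dual_basisE linear_sum.
  by apply: eq_bigr => j _; rewrite linearZ.
under [RHS]eq_bigr => k _ do rewrite e2.
rewrite exchange_big; apply: eq_bigr => j _ /=.
transitivity (g3 (dual_basis j)
  (\sum_k coord (vbasis {:A}) k (tbasis i * tbasis j) *:
    (l \o amull (tbasis k))%VF)).
  congr (g3 _ _); apply/lfunP => a; rewrite !comp_amullE sum_lfunE mulrA.
  rewrite {1}[tbasis i * _]tbasisE mulr_suml linear_sum; apply: eq_bigr => k _.
  by rewrite -scalerAl linearZ scale_lfunE comp_amullE.
rewrite linear_sum; apply: eq_bigr => k _; rewrite linearZ /=.
by rewrite comp_amullE lfunE.
Qed.

Lemma invdP (f : dual A -> dual A) :
  invd f <-> forall l a b, f l (a * b) = \sum_(p <- coprod l) f p.1 a * p.2 b.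
Proof.
have tin2_lin (l' : dual A) : linear (fun l => tin l' * tin l).
  by move=> a u v; rewrite linearP mulrDr scalerAr.
split=> [fP l a b|fP l].
- pose ev : dual A -> A -> C^o := fun l a => l a.
  have evl a' : linear (ev ^~ a') by move=> c u v; rewrite /ev !lfunE /= lfunE.
  have evr l' : linear (ev l') by move=> c u v; rewrite /ev linearP.
  have ev2 (l1 l2 : dual A) :
      tzip ev (tin l1 * tin l2) (tin a * tin b) = l1 a * l2 b.
    have := tzip_prod evl evr [:: l1; l2] [:: a; b].
    by rewrite /= !big_cons !big_nil !mulr1.
  have := congr1 (tzip ev ^~ (tin a * tin b)) (fP l).
  pose z : {linear tensor (dual A) -> C^o} :=
    HB.pack (tzip ev ^~ (tin a * tin b))
      (GRing.isLinear.Build C (tensor (dual A)) C^o _ _ (tzip_is_linearl ev _)).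
  rewrite -[tzip _ _ _]/(z _) -[tzip _ _ _ in RHS]/(z _) !linear_sum /=.
  under eq_bigr do rewrite ev2.
  by rewrite coprodE => ->; apply: eq_bigr => p _; rewrite ev2.
- rewrite (coprod_bilin tin2_lin).
  under [RHS]eq_bigr => p _ do
    rewrite (dual_basisE (f p.1)) (dual_basisE p.2) !linear_sum mulr_suml.
  rewrite [RHS]exchange_big; apply: eq_bigr => i _ /=.
  under [RHS]eq_bigr => p _ do rewrite mulr_sumr.
  rewrite [RHS]exchange_big; apply: eq_bigr => j _ /=.
  under [RHS]eq_bigr => p _ do rewrite !linearZ /= -scalerAl -scalerAr scalerA.
  by rewrite -scaler_suml fP.
Qed.

Lemma invd_ipair (f : dual A -> dual A) : invd f -> forall l,
  f l = \sum_(p <- coprod l) ipair f p.1 *: p.2.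
Proof.
move=> /invdP fP l; apply/lfunP => a; rewrite sum_lfunE -[a in LHS]mul1r fP.
by apply: eq_bigr => p _; rewrite lfunE.
Qed.

End DualCoalgebra.

Section Main.
Variables (C : fieldType) (K E : falgType C).
Variable x : 'Hom(dual K, 'End(dual E)).

(* The transpose y = x^t of x, written through its values
   <y(f), l> = <x(l), f>: see [invd_ipair], [ipair_transp] and [transp_invd]. *)
Definition transp (f : dual E) : 'End(dual K) :=
  linfun (fun l : dual K => \sum_(p <- coprod l) ipair (x p.1) f *: p.2).

(* y_t: see [transp_tE]; y(f) is the transpose of the left multiplication by
   y_t(f) by [transp_lmul]. *)
Definition transp_t (f : dual E) : K :=
  \sum_i ipair (transp f) (dual_basis i) *: tbasis i.

(* The pairing of T(K) with T(K^* ), factor by factor: see [pairing_prod]. *)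
Definition pairing (u : tensor K) (w : tensor (dual K)) : C :=
  (tzip (fun (a : K) (l : dual K) => l a : C^o) u w : C^o).

(* The operators X(l), given on words by X(l)(1) = \epsilon(l) 1 and
   X(l)(f w) = \sum_k x(l'_k)(f) X(l''_k)(w): see [Xop1], [Xop_in], [XopM]. *)
Fixpoint Xword (s : seq 'I_(\dim {:dual E})) (l : dual K) : tensor (dual E) :=
  if s is i :: s' then
    \sum_(p <- coprod l) tin (x p.1 (tbasis i)) * Xword s' p.2
  else (counit l)%:A.

Definition Xop (l : dual K) : tensor (dual E) -> tensor (dual E) :=
  tlin (fun s => Xword s l).

(* \pi_x, as an operator on T(F): see [pi_op1], [pi_opM] and [pi_op_in]. *)
Definition pi_op (w : tensor (dual K)) (u : tensor (dual E)) : tensor (dual E) :=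
  tlin (fun s => foldr (fun i => Xop (tbasis i)) u s) w.

(* R_m(U_x) *)
Definition relations (m : nat) : set (tensor (dual K)) :=
  [set w | tdeg_le m w /\ forall u, pi_op w u = 0].

Definition orthK (m : nat) (B : set (tensor (dual K))) : set (tensor K) :=
  [set u | tdeg_le m u /\ forall w, B w -> pairing u w = 0].

Definition orthL (m : nat) (B : set (tensor K)) : set (tensor (dual K)) :=
  [set w | tdeg_le m w /\ forall u, B u -> pairing u w = 0].

(* T_m(K) as the direct product of the algebras K^{(x) i}, i <= m. Its product
   is not the product of the ring [tensor K]; its unit is the sum of the
   1 (x) ... (x) 1 (n factors) for n <= m. *)
Definition dprod_mul (u v : tensor K) : tensor K :=
  tzip (fun a b : K => tin (a * b)) u v.

Definition dprod_one (m : nat) : tensor K := \sum_(n < m.+1) tin 1 ^+ n.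

(* The unit is not required to be in S: it is added to the generators of
   [Bsup]. *)
Definition dprod_subalg (m : nat) (S : set (tensor K)) : Prop :=
  [/\ S `<=` tdeg_le m, S 0,
      forall (c : C) u v, S u -> S v -> S (c *: u + v)
    & forall u v, S u -> S v -> S (dprod_mul u v)].

(* The n-fold iterate of \Delta_{F,op} f = \sum_k f''_k (x) f'_k. *)
Fixpoint coprod_op_iter (n : nat) (f : dual E) : tensor (dual E) :=
  if n is n'.+1 then
    \sum_(p <- coprod f) tin p.2 * coprod_op_iter n' p.1
  else tin f.

(* [tlift (tin \o y_t)] restricts to the n-th tensor power of y_t on the words
   of length n. *)
Definition Yop (m : nat) (f : dual E) : tensor K :=
  (counit f)%:A +
  \sum_(1 <= n < m.+1) tlift (tin \o transp_t) (coprod_op_iter n.-1 f).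

(* B_m *)
Definition Bsub (m : nat) : set (tensor K) := orthK m (relations m).

(* B^m *)
Definition Bsup (m : nat) : set (tensor K) :=
  smallest (dprod_subalg m) ([set dprod_one m] `|` range (Yop m)).

Lemma transp_fun_is_linear f : linear
  (fun l : dual K => \sum_(p <- coprod l) ipair (x p.1) f *: p.2).
Proof.
apply: (coprod_linear (G := fun l1 l2 => ipair (x l1) f *: l2)) => l' a u v.
by rewrite scalerDr !scalerA mulrC.
Qed.

Lemma transpE f l :
  transp f l = \sum_(p <- coprod l) ipair (x p.1) f *: p.2.
Proof.
pose g : {linear dual K -> dual K} := HB.pack
  (fun l : dual K => \sum_(p <- coprod l) ipair (x p.1) f *: p.2)
  (GRing.isLinear.Build C (dual K) (dual K) _ _ (transp_fun_is_linear f)).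
exact: (lfunE g).
Qed.

Lemma ipair_x_linear f : linear (fun l => ipair (x l) f : C^o).
Proof.
by move=> a u v; rewrite /ipair /counit linearP !(add_lfunE, scale_lfunE).
Qed.

Lemma ipair_transp f l : ipair (transp f) l = ipair (x l) f.
Proof.
pose g : {linear dual K -> C^o} := HB.pack (fun l => ipair (x l) f : C^o)
  (GRing.isLinear.Build C (dual K) C^o _ _ (ipair_x_linear f)).
rewrite -[RHS]/(g l) -{2}[l]coprod_counitr linear_sum /ipair transpE /counit.
rewrite sum_lfunE; apply: eq_bigr => p _.
by rewrite linearZ lfunE /= [RHS]mulrC.
Qed.

Lemma transp_tE f (l : dual K) : l (transp_t f) = ipair (transp f) l.
Proof.
rewrite /transp_t linear_sum [in RHS](dual_basisE l) /ipair /counit.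
rewrite (linear_sum (transp f)) sum_lfunE; apply: eq_bigr => i _.
by rewrite !linearZ scale_lfunE /= [LHS]mulrC.
Qed.

Lemma transp_lmul f (l : dual K) a : transp f l a = l (transp_t f * a).
Proof.
rewrite transpE sum_lfunE -coprodE; apply: eq_bigr => p _.
by rewrite lfunE /= transp_tE ipair_transp.
Qed.

Lemma transp_invd f : invd (transp f).
Proof.
apply/invdP => l a b; rewrite transp_lmul mulrA -coprodE.
by apply: eq_bigr => p _; rewrite transp_lmul.
Qed.

Lemma pairing_prod (vs : seq K) (ls : seq (dual K)) :
  pairing (\prod_(v <- vs) tin v) (\prod_(l <- ls) tin l) =
  if size vs == size ls then \prod_(p <- zip vs ls) p.2 p.1 else 0.
Proof.
rewrite /pairing tzip_prod // => [l|v] a u w; first by rewrite linearP.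
by rewrite !lfunE /= lfunE.
Qed.

Lemma dprod_mul_prod (vs ws : seq K) :
  dprod_mul (\prod_(v <- vs) tin v) (\prod_(w <- ws) tin w) =
  if size vs == size ws then \prod_(p <- zip vs ws) tin (p.1 * p.2) else 0.
Proof.
rewrite /dprod_mul tzip_prod // => v a u w.
  by rewrite mulrDl -scalerAl linearP.
by rewrite mulrDr -scalerAr linearP.
Qed.

Lemma Xword_is_linear s : linear (Xword s).
Proof.
elim: s => [|i s IHs] /=.
  by move=> a u v; rewrite /counit !lfunE /= lfunE scalerDl scalerA.
apply: (coprod_linear
  (G := fun l1 l2 => tin (x l1 (tbasis i)) * Xword s l2)) => l' a u v.
by rewrite IHs mulrDr scalerAr.
Qed.

Lemma Xop_is_linear t : linear (Xop ^~ t).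
Proof.
move=> a u v; elim/tensor_word_ind: t => [|b t1 t2 IH1 IH2|s].
- by rewrite /Xop !linear0 addr0.
- rewrite /Xop in IH1 IH2 *; rewrite !tlin_is_linear IH1 IH2 !scalerDr !scalerA.
  by rewrite [b * a]mulrC; apply: addrACA.
- by rewrite /Xop !tlin_word Xword_is_linear.
Qed.

Lemma Xop_is_linearr l : linear (Xop l).
Proof. exact: tlin_is_linear. Qed.

Lemma Xop0 l : Xop l 0 = 0.
Proof. exact: linear0. Qed.

Lemma Xop1 l : Xop l 1 = (counit l)%:A.
Proof. by rewrite /Xop tlin1. Qed.

Lemma Xop_tinM l f t :
  Xop l (tin f * t) = \sum_(p <- coprod l) tin (x p.1 f) * Xop p.2 t.
Proof.
rewrite /Xop tlin_tinM /=.
under [RHS]eq_bigr => p _ do rewrite {1}[f]tbasisE !linear_sum mulr_suml.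
rewrite [RHS]exchange_big; apply: eq_bigr => i _ /=.
under [RHS]eq_bigr => p _ do rewrite !linearZ /= -scalerAl.
rewrite -scaler_sumr; congr (_ *: _).
elim/tensor_word_ind: t => [|b t1 t2 IH1 IH2|s].
- by rewrite linear0 big1 // => p _; rewrite linear0 mulr0.
- rewrite tlin_is_linear IH1 IH2 scaler_sumr -big_split; apply: eq_bigr => p _ /=.
  by rewrite tlin_is_linear mulrDr scalerAr.
- by rewrite tlin_word; apply: eq_bigr => p _; rewrite tlin_word.
Qed.

Lemma Xop_in l f : Xop l (tin f) = tin (x l f).
Proof.
rewrite -[tin f]mulr1 Xop_tinM -{2}[l]coprod_counitr linear_sum sum_lfunE linear_sum.
apply: eq_bigr => p _; rewrite Xop1 linearZ lfunE linearZ /=.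
by rewrite -scalerAr mulr1.
Qed.

Lemma XopM l w1 w2 :
  Xop l (w1 * w2) = \sum_(p <- coprod l) Xop p.1 w1 * Xop p.2 w2.
Proof.
elim/tensor_ind: w1 l => [l|a u v IHu IHv l|l|f t IHt l].
- by rewrite mul0r Xop0 big1 // => p _; rewrite Xop0 mul0r.
- rewrite mulrDl -scalerAl Xop_is_linearr IHu IHv scaler_sumr -big_split.
  by apply: eq_bigr => p _ /=; rewrite Xop_is_linearr mulrDl scalerAl.
- pose g : {linear dual K -> tensor (dual E)} := HB.pack (Xop ^~ w2)
    (GRing.isLinear.Build C (dual K) (tensor (dual E)) _ _ (Xop_is_linear w2)).
  rewrite mul1r -[LHS]/(g l) -[l in LHS]coprod_counitl linear_sum.
  by apply: eq_bigr => p _; rewrite linearZ Xop1 mulr_algl.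
- rewrite -mulrA Xop_tinM; under eq_bigr do rewrite IHt mulr_sumr.
  under [RHS]eq_bigr do rewrite Xop_tinM mulr_suml.
  under eq_bigr do under eq_bigr do rewrite mulrA.
  apply: (coprod_coassoc
    (G := fun l1 l2 l3 => tin (x l1 f) * Xop l2 t * Xop l3 w2)).
  + by move=> l1 l3 a u v; rewrite Xop_is_linear mulrDr mulrDl -scalerAr -scalerAl.
  + by move=> l1 l2 a u v; rewrite Xop_is_linear mulrDr -scalerAr.
Qed.

Lemma pi_op_is_linear u : linear (pi_op ^~ u).
Proof. exact: tlin_is_linear. Qed.

Lemma pi_op1 u : pi_op 1 u = u.
Proof. by rewrite /pi_op tlin1. Qed.

Lemma pi_op_tinM l w u : pi_op (tin l * w) u = Xop l (pi_op w u).
Proof.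
pose g t : {linear dual K -> tensor (dual E)} := HB.pack (Xop ^~ t)
  (GRing.isLinear.Build C (dual K) (tensor (dual E)) _ _ (Xop_is_linear t)).
rewrite /pi_op tlin_tinM /= -[RHS]/(g _ l) [l in RHS]tbasisE linear_sum.
apply: eq_bigr => i _; rewrite linearZ; congr (_ *: _).
elim/tensor_word_ind: w => [|b t1 t2 IH1 IH2|s].
- by rewrite /= !linear0 Xop0.
- by rewrite /= !tlin_is_linear IH1 IH2 Xop_is_linearr.
- by rewrite /= !tlin_word.
Qed.

Lemma pi_op_in l u : pi_op (tin l) u = Xop l u.
Proof. by rewrite -[tin l]mulr1 pi_op_tinM pi_op1. Qed.

Lemma pi_opM w1 w2 u : pi_op (w1 * w2) u = pi_op w1 (pi_op w2 u).
Proof.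
elim/tensor_ind: w1 => [|a t1 t2 IH1 IH2||l t IHt].
- by rewrite mul0r /pi_op !linear0.
- by rewrite mulrDl -scalerAl !pi_op_is_linear IH1 IH2.
- by rewrite mul1r pi_op1.
- by rewrite -mulrA !pi_op_tinM IHt.
Qed.

End Main.

(* Main.v *)
(* A right-invariant operator on T(F) is determined by its composite with the
   counit, so w is a relation iff the functional e_t : w |-> \epsilon(\pi_x(w) t)
   vanishes at w for every t in T(F). Since \epsilon is multiplicative and X(l)
   acts on products through the coproduct of l, the map t |-> e_t turns the
   product of T(F) into the convolution product on T_m(L)^* = T_m(K), which is
   the direct product structure. It sends 1 to the unit and f in F to
   Y^m_{t,op}(f), because \pi_x(l_1 ... l_n) f = x(l_1) ... x(l_n) f and each
   x(l) is right invariant. Hence the functionals e_t form exactly B^m, and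
   R_m(U_x) is the orthogonal of B^m; biorthogonality in finite dimension gives
   B_m = B^m. *)
From HB Require Import structures.
Require Import Defs.
From mathcomp Require Import all_boot all_algebra falgebra finmap.
From mathcomp.multinomials Require Import monalg.
From mathcomp Require Import boolp classical_sets reals complex.

Set Implicit Arguments.
Unset Strict Implicit.
Unset Printing Implicit Defensive.

Import GRing.Theory.
Local Open Scope classical_set_scope.
Local Open Scope ring_scope.

(** * Linearity rules for plain functions with a proof of linearity *)

Section LinearPredicate.
Variables (C : fieldType) (V W : lmodType C) (g : V -> W).
Hypothesis g_lin : linear g.

Let g' : {linear V -> W} := HB.pack g (GRing.isLinear.Build C V W _ g g_lin).

Lemma linear_pred0 : g 0 = 0.
Proof. exact: (linear0 g'). Qed.

Lemma linear_predZ a u : g (a *: u) = a *: g u.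
Proof. exact: (linearZ_LR g'). Qed.

Lemma linear_pred_sum I (r : seq I) (P : pred I) (G : I -> V) :
  g (\sum_(i <- r | P i) G i) = \sum_(i <- r | P i) g (G i).
Proof. exact: (linear_sum g'). Qed.

End LinearPredicate.

(** * The degree filtration [T_m(V)] *)

Section Degree.
Variables (C : fieldType) (V : vectType C).
Notation TV := (tensor V).

Lemma tword_prod (s : seq 'I_(\dim {:V})) :
  tword s = \prod_(i <- s) tin (tbasis i) :> TV.
Proof.
elim: s => [|i s IHs]; first by rewrite big_nil tword_nil.
by rewrite big_cons tword_cons IHs tin_tbasis.
Qed.

Lemma tensor_sumE (w : TV) : w = \sum_(k <- msupp w) w@_k *: tword k.
Proof.
have -> : \sum_(k <- msupp w) w@_k *: tword k = tlin (@tword C V) w.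
  by rewrite tlin.unlock.
elim/tensor_word_ind: w => [|a u v IHu IHv|s].
- by rewrite linear0.
- by rewrite tlin_is_linear -IHu -IHv.
- by rewrite tlin_word.
Qed.

(** An element of [T_m(V)] expands on words of length at most [m] only. *)
Lemma tdeg_le_ind (m : nat) (P : TV -> Prop) :
    P 0 -> (forall a u v, P u -> P v -> P (a *: u + v)) ->
    (forall s, (size s <= m)%N -> P (tword s)) ->
  forall w, tdeg_le m w -> P w.
Proof.
move=> P0 Plin Pw w wm; rewrite [w]tensor_sumE big_seq.
by apply: big_rec => // k t kw Pt; apply: Plin => //; apply: Pw; apply: wm.
Qed.

Lemma tdeg_le0 m : tdeg_le m (0 : TV).
Proof. by move=> k; rewrite /= msupp0. Qed.

Lemma tdeg_leD m a (u v : TV) :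
  tdeg_le m u -> tdeg_le m v -> tdeg_le m (a *: u + v).
Proof.
move=> um vm k /(fsubsetP (msuppD_le _ _)); rewrite in_fsetU => /orP[|/vm //].
by move=> /(fsubsetP (msuppZ_le _ _)) /um.
Qed.

Lemma tdeg_le_sum m I (r : seq I) (P : pred I) (G : I -> TV) :
  (forall i, P i -> tdeg_le m (G i)) -> tdeg_le m (\sum_(i <- r | P i) G i).
Proof.
move=> Gm; apply: big_rec => [|i t Pi tm]; first exact: tdeg_le0.
by rewrite -[G i]scale1r; apply: tdeg_leD => //; apply: Gm.
Qed.

Lemma tdeg_le_word m s : (size s <= m)%N -> tdeg_le m (tword s : TV).
Proof. by move=> sm k /(fsubsetP msuppU_le); rewrite inE => /eqP ->. Qed.

Lemma tdeg_le_leq m n (u : TV) : (m <= n)%N -> tdeg_le m u -> tdeg_le n u.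
Proof. by move=> mn um k /um /leq_trans; apply. Qed.

Lemma tdeg_le_tinM m v (t : TV) : tdeg_le m t -> tdeg_le m.+1 (tin v * t).
Proof.
move: t; apply: tdeg_le_ind => [|a t1 t2 IH1 IH2|s sm].
- by rewrite mulr0; apply: tdeg_le0.
- by rewrite mulrDr -scalerAr; apply: tdeg_leD.
- rewrite {1}[v]tbasisE linear_sum mulr_suml; apply: tdeg_le_sum => i _.
  rewrite linearZ /= -scalerAl tin_tbasis -tword_cons -[_ *: _]addr0.
  by apply: tdeg_leD; [apply: tdeg_le_word | apply: tdeg_le0].
Qed.

Lemma tdeg_le_prod (vs : seq V) m :
  (size vs <= m)%N -> tdeg_le m (\prod_(v <- vs) tin v : TV).
Proof.
move=> le; apply: tdeg_le_leq le _; elim: vs => [|v vs IH].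
  by rewrite big_nil -tword_nil; apply: tdeg_le_word.
by rewrite big_cons; apply: tdeg_le_tinM.
Qed.

End Degree.

(** * The pairing of [T(K)] with [T(L)], one letter at a time *)

Section Pairing.
Variables (C : fieldType) (K : falgType C).

Lemma dual_linearl (a : K) : linear (fun l : dual K => l a : C^o).
Proof. by move=> b u v; rewrite add_lfunE scale_lfunE. Qed.

Lemma pairing_linearl w : linear (fun u : tensor K => pairing u w : C^o).
Proof. exact: tzip_is_linearl. Qed.

Lemma pairing_linearr u : linear (fun w : tensor (dual K) => pairing u w : C^o).
Proof. exact: tzip_is_linearr. Qed.

Lemma pairing_tinM a (l : dual K) u w :
  pairing (tin a * u) (tin l * w) = l a * pairing u w.
Proof.
rewrite /pairing tzip_tinM // => [l'|a'] b v v'; first by rewrite linearP.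
exact: dual_linearl.
Qed.

Lemma pairing1_tinM (l : dual K) w : pairing 1 (tin l * w) = 0.
Proof. by rewrite /pairing tzip1_tin. Qed.

Lemma pairing_tinM1 (a : K) u : pairing (tin a * u) 1 = 0.
Proof. by rewrite /pairing tzip_tin1. Qed.

Lemma pairing11 : pairing 1 (1 : tensor (dual K)) = 1.
Proof. by rewrite /pairing tzip11. Qed.

End Pairing.

(** * Right translations and the counit of [T(F)] *)

Section Invariance.
Variables (C : fieldType) (E : falgType C).
Notation F := (dual E).

Lemma counit_linear : linear (fun f : F => counit f : C^o).
Proof. exact: dual_linearl. Qed.

Definition tcounit (u : tensor F) : C :=
  (tlift (fun f : F => counit f : C^o) u : C^o).

Lemma tcounit_linear : linear (fun u => tcounit u : C^o).
Proof. exact: tlift_is_linear. Qed.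

Lemma tcounit1 : tcounit 1 = 1.
Proof. by rewrite /tcounit tlift1. Qed.

Lemma tcounit0 : tcounit 0 = 0.
Proof. by rewrite (linear_pred0 tcounit_linear). Qed.

Lemma tcounitM u v : tcounit (u * v) = tcounit u * tcounit v.
Proof. by rewrite /tcounit (tliftM counit_linear). Qed.

Lemma tcounit_in f : tcounit (tin f) = counit f.
Proof. by rewrite /tcounit (tlift_in counit_linear). Qed.

(** Evaluation at [a] of the second leg of the coproduct, see [rtrans_coprod]. *)
Definition rtrans (a : E) (f : F) : F := (f \o amulr a)%VF.

Lemma rtransE a f b : rtrans a f b = f (b * a).
Proof. by rewrite /rtrans !lfunE /= lfunE. Qed.

Lemma rtrans_coprod a (f : F) :
  rtrans a f = \sum_(p <- coprod f) p.2 a *: p.1.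
Proof.
apply/lfunP => b; rewrite rtransE -coprodE sum_lfunE.
by apply: eq_bigr => p _; rewrite scale_lfunE [LHS]mulrC.
Qed.

Lemma counit_rtrans a f : counit (rtrans a f) = f a.
Proof. by rewrite /counit rtransE mul1r. Qed.

(** Evaluating the second leg of [\Delta \o h = (h (x) id) \o \Delta] at [a] gives the commutation
    with [rtrans a]; together these evaluations lose nothing, since [E] separates the elements of
    [F]. *)
Lemma invd_rtrans (h : F -> F) :
  linear h -> invd h <-> forall a f, h (rtrans a f) = rtrans a (h f).
Proof.
move=> h_lin; have hr a f b : h (rtrans a f) b =
    \sum_(p <- coprod f) h p.1 b * p.2 a.
  rewrite rtrans_coprod (linear_pred_sum h_lin) sum_lfunE.
  apply: eq_bigr => p _.
  by rewrite (linear_predZ h_lin) scale_lfunE [LHS]mulrC.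
rewrite invdP; split=> hP.
- by move=> a f; apply/lfunP => b; rewrite hr rtransE hP.
- by move=> f b a; rewrite -hr hP rtransE.
Qed.

(* Right translation on T(F) by an element of T(E), factor by factor; its
   commutation with an operator expresses the right invariance of the latter
   without the coproduct of T(F). *)
Definition ttrans (v : tensor E) (u : tensor F) : tensor F :=
  tzip (fun a f => tin (rtrans a f)) v u.

Lemma rtrans_linearl f : linear (fun a => tin (rtrans a f)).
Proof.
move=> b a1 a2; rewrite -linearP; congr (tin _); apply/lfunP => a.
by rewrite add_lfunE scale_lfunE !rtransE mulrDr -scalerAr linearP.
Qed.

Lemma rtrans_linearr a : linear (fun f => tin (rtrans a f)).
Proof.
move=> b f1 f2; rewrite -linearP; congr (tin _); apply/lfunP => c.
by rewrite add_lfunE scale_lfunE !rtransE add_lfunE scale_lfunE.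
Qed.

Lemma ttrans_tinM a v f u :
  ttrans (tin a * v) (tin f * u) = tin (rtrans a f) * ttrans v u.
Proof. exact: (tzip_tinM rtrans_linearl rtrans_linearr). Qed.

Lemma ttrans_linearl u : linear (ttrans ^~ u).
Proof. exact: tzip_is_linearl. Qed.

Lemma ttrans_linearr v : linear (ttrans v).
Proof. exact: tzip_is_linearr. Qed.

Lemma ttrans11 : ttrans 1 1 = 1.
Proof. by rewrite /ttrans tzip11. Qed.

Lemma ttrans1_tinM f u : ttrans 1 (tin f * u) = 0.
Proof. by rewrite /ttrans tzip1_tin. Qed.

Lemma ttrans_tinM1 a v : ttrans (tin a * v) 1 = 0.
Proof. by rewrite /ttrans tzip_tin1. Qed.

(** Letter by letter this is [counit_rtrans], the counit being multiplicative. It lets the counit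
    detect invariant operators. *)
Lemma tcounit_ttrans v u : tcounit (ttrans v u) = pairing v u.
Proof.
elim/tensor_ind: v u => [|a v1 v2 IH1 IH2||a v IH] u.
- by rewrite (linear_pred0 (ttrans_linearl u)) tcounit0
    (linear_pred0 (pairing_linearl u)).
- by rewrite ttrans_linearl tcounit_linear IH1 IH2 pairing_linearl.
- elim/tensor_ind: u => [|b u1 u2 IH1 IH2||f u _].
  + by rewrite (linear_pred0 (ttrans_linearr _)) tcounit0
      (linear_pred0 (pairing_linearr _)).
  + by rewrite ttrans_linearr tcounit_linear IH1 IH2 pairing_linearr.
  + by rewrite ttrans11 tcounit1 pairing11.
  + by rewrite ttrans1_tinM tcounit0 pairing1_tinM.
- elim/tensor_ind: u => [|b u1 u2 IH1 IH2||f u _].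
  + by rewrite (linear_pred0 (ttrans_linearr _)) tcounit0
      (linear_pred0 (pairing_linearr _)).
  + by rewrite ttrans_linearr tcounit_linear IH1 IH2 pairing_linearr.
  + by rewrite ttrans_tinM1 tcounit0 pairing_tinM1.
  + by rewrite ttrans_tinM tcounitM tcounit_in counit_rtrans IH pairing_tinM.
Qed.

(** The basis of [E] dual to [vbasis] of [F], which indexes the words of [T(F)] and need not be
    [dual_basis]. *)
Definition predual_basis (i : 'I_(\dim {:F})) : E :=
  \sum_j coord (vbasis {:F}) i (dual_basis j) *: tbasis j.

Lemma predual_basisE i (f : F) : f (predual_basis i) = coord (vbasis {:F}) i f.
Proof.
rewrite /predual_basis linear_sum [in RHS](dual_basisE f) linear_sum.
by apply: eq_bigr => j _; rewrite !linearZ [LHS]mulrC.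
Qed.

Lemma pairing_predual s (u : tensor F) :
  pairing (\prod_(i <- s) tin (predual_basis i)) u = u@_(FMonom s).
Proof.
elim/tensor_word_ind: u => [|a u v IHu IHv|t].
- by rewrite (linear_pred0 (pairing_linearr _)) mcoeff0.
- by rewrite pairing_linearr IHu IHv mcoeffD mcoeffZ.
have := pairing_prod (map predual_basis s) (map (@tbasis _ _) t).
rewrite !big_map -tword_prod !size_map => ->.
have -> : (tword t : tensor F)@_(FMonom s) = (s == t)%:R.
  by rewrite /tword mcoeffU1 eq_sym.
elim: s t => [|i s IHs] [|j t] /=; rewrite ?big_nil ?eqSS ?eqseq_cons //.
rewrite big_cons /= predual_basisE coord_tbasis; case: (j =P i) => [->|] /=.
  by rewrite mul1r eqxx /= IHs.
by move/eqP; rewrite eq_sym => /negPf ->; rewrite mul0r if_same.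
Qed.

Lemma pairing_nondegr (u : tensor F) : (forall v, pairing v u = 0) -> u = 0.
Proof.
by move=> u0; apply/malgP => -[s]; rewrite -pairing_predual u0 mcoeff0.
Qed.

End Invariance.

(* [words_coprod [:: l_1; ...; l_n]] lists the terms of the coproduct
   \Delta(l_1) ... \Delta(l_n) of the word l_1 ... l_n of T(K^* ). *)
Fixpoint words_coprod (C : fieldType) (K : falgType C) (ls : seq (dual K)) :
    seq (seq (dual K) * seq (dual K)) :=
  if ls is l :: ls' then
    [seq (p.1 :: q.1, p.2 :: q.2) | p <- coprod l, q <- words_coprod ls']
  else [:: ([::], [::])].
Arguments words_coprod {C K} ls.

(** * The direct product algebra as dual of the coproduct on words *)

Section WordsCoprod.
Variables (C : fieldType) (K : falgType C).
Notation L := (dual K).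

Lemma big_words_coprod_cons (W : zmodType) (G : seq L -> seq L -> W) l ls :
  \sum_(q <- words_coprod (l :: ls)) G q.1 q.2 =
  \sum_(p <- coprod l) \sum_(q <- words_coprod ls) G (p.1 :: q.1) (p.2 :: q.2).
Proof. by rewrite big_allpairs_dep. Qed.

(** Each letter gives one letter to each leg; this is why [T_m(L)] is a subcoalgebra. *)
Lemma size_words_coprod (ls : seq L) q :
  q \in words_coprod ls -> (size q.1 = size ls) * (size q.2 = size ls)%type.
Proof.
elim: ls q => [|l ls IH] q; first by rewrite inE => /eqP ->.
by case/allpairsP=> -[p r] [/= _ /IH r_size ->] /=; rewrite !r_size.
Qed.

Lemma dprod_mul_tinM (a b : K) u v :
  dprod_mul (tin a * u) (tin b * v) = tin (a * b) * dprod_mul u v.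
Proof.
rewrite /dprod_mul tzip_tinM // => [d|d] c e g.
  by rewrite mulrDl -scalerAl linearP.
by rewrite mulrDr -scalerAr linearP.
Qed.

Lemma dprod_mul_linearl (v : tensor K) : linear (fun u => dprod_mul u v).
Proof. exact: tzip_is_linearl. Qed.

Lemma dprod_mul_linearr (u : tensor K) : linear (dprod_mul u).
Proof. exact: tzip_is_linearr. Qed.

Lemma dprod_mul11 : dprod_mul 1 1 = 1 :> tensor K.
Proof. by rewrite /dprod_mul tzip11. Qed.

Lemma dprod_mul1_tinM (a : K) u : dprod_mul 1 (tin a * u) = 0.
Proof. by rewrite /dprod_mul tzip1_tin. Qed.

Lemma dprod_mul_tinM1 (a : K) u : dprod_mul (tin a * u) 1 = 0.
Proof. by rewrite /dprod_mul tzip_tin1. Qed.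

(** Each first letter is split by [coprodE]; when the lengths disagree both sides vanish, as both
    legs of a coproduct term are as long as [ls]. *)
Lemma pairing_dprod_mul (u v : tensor K) (ls : seq L) :
  pairing (dprod_mul u v) (\prod_(l <- ls) tin l) =
  \sum_(q <- words_coprod ls)
    pairing u (\prod_(l <- q.1) tin l) * pairing v (\prod_(l <- q.2) tin l).
Proof.
elim/tensor_ind: u v ls => [|a u1 u2 IH1 IH2||a u IH] v ls.
- rewrite (linear_pred0 (dprod_mul_linearl _)) (linear_pred0 (pairing_linearl _)).
  by rewrite big1 // => q _; rewrite (linear_pred0 (pairing_linearl _)) mul0r.
- rewrite dprod_mul_linearl pairing_linearl IH1 IH2 scaler_sumr -big_split.
  by apply: eq_bigr => q _; rewrite pairing_linearl mulrDl scalerAl.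
- elim/tensor_ind: v => [|b v1 v2 IH1 IH2||b v _].
  + rewrite (linear_pred0 (dprod_mul_linearr _)) (linear_pred0 (pairing_linearl _)).
    by rewrite big1 // => q _; rewrite (linear_pred0 (pairing_linearl _)) mulr0.
  + rewrite dprod_mul_linearr pairing_linearl IH1 IH2 scaler_sumr -big_split.
    by apply: eq_bigr => q _; rewrite pairing_linearl mulrDr scalerAr.
  + rewrite dprod_mul11; case: ls => [|l ls].
      by rewrite /= big_seq1 !big_nil pairing11 mulr1.
    rewrite (big_words_coprod_cons (fun s t => _ (\prod_(l <- s) tin l) *
      _ (\prod_(l <- t) tin l))) big_cons pairing1_tinM.
    rewrite big1 // => p _; rewrite big1 // => q _.
    by rewrite big_cons pairing1_tinM mul0r.
  + rewrite dprod_mul1_tinM (linear_pred0 (pairing_linearl _)).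
    case: ls => [|l ls].
      by rewrite /= big_seq1 !big_nil pairing_tinM1 mulr0.
    rewrite (big_words_coprod_cons (fun s t => _ (\prod_(l <- s) tin l) *
      _ (\prod_(l <- t) tin l))).
    rewrite big1 // => p _; rewrite big1 // => q _.
    by rewrite big_cons pairing1_tinM mul0r.
- elim/tensor_ind: v => [|b v1 v2 IH1 IH2||b v _].
  + rewrite (linear_pred0 (dprod_mul_linearr _)) (linear_pred0 (pairing_linearl _)).
    by rewrite big1 // => q _; rewrite (linear_pred0 (pairing_linearl _)) mulr0.
  + rewrite dprod_mul_linearr pairing_linearl IH1 IH2 scaler_sumr -big_split.
    by apply: eq_bigr => q _; rewrite pairing_linearl mulrDr scalerAr.
  + rewrite dprod_mul_tinM1 (linear_pred0 (pairing_linearl _)).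
    case: ls => [|l ls].
      by rewrite /= big_seq1 !big_nil pairing_tinM1 mul0r.
    rewrite (big_words_coprod_cons (fun s t => _ (\prod_(l <- s) tin l) *
      _ (\prod_(l <- t) tin l))).
    rewrite big1 // => p _; rewrite big1 // => q _.
    by rewrite [in pairing 1 _]big_cons pairing1_tinM mulr0.
  + rewrite dprod_mul_tinM; case: ls => [|l ls].
      by rewrite /= big_seq1 !big_nil !pairing_tinM1 mul0r.
    rewrite (big_words_coprod_cons (fun s t => _ (\prod_(l <- s) tin l) *
      _ (\prod_(l <- t) tin l))).
    rewrite big_cons pairing_tinM IH -coprodE mulr_suml; apply: eq_bigr => p _.
    rewrite mulr_sumr; apply: eq_bigr => q _.
    by rewrite !big_cons !pairing_tinM mulrACA.
Qed.

End WordsCoprod.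

(** * The operators [\pi_x(w)] and the elements [Y^m_{t,op}(f)] *)

Section Transpose.
Variables (C : fieldType) (K E : falgType C).
Variable x : 'Hom(dual K, 'End(dual E)).
Notation L := (dual K).
Notation F := (dual E).

Lemma pi_op_linearr w : linear (pi_op x w).
Proof.
elim/tensor_ind: w => [|a w1 w2 IH1 IH2||l w IH] b u v.
- by rewrite !(linear_pred0 (pi_op_is_linear x _)) scaler0 addr0.
- rewrite !pi_op_is_linear IH1 IH2 !scalerDr !scalerA [b * a]mulrC.
  exact: addrACA.
- by rewrite !pi_op1.
- by rewrite !pi_op_tinM IH Xop_is_linearr.
Qed.

(** Composing the operators [X(l)] multiplies the coproducts through which they act on products. *)
Lemma pi_op_words_mul (ls : seq L) u1 u2 :
  pi_op x (\prod_(l <- ls) tin l) (u1 * u2) =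
  \sum_(q <- words_coprod ls)
    pi_op x (\prod_(l <- q.1) tin l) u1 * pi_op x (\prod_(l <- q.2) tin l) u2.
Proof.
elim: ls => [|l ls IH]; first by rewrite /= big_seq1 !big_nil !pi_op1.
rewrite (big_words_coprod_cons (fun s t => pi_op x (\prod_(l <- s) tin l) u1 *
  pi_op x (\prod_(l <- t) tin l) u2)).
rewrite big_cons pi_op_tinM IH (linear_pred_sum (Xop_is_linearr x l)).
under eq_bigr do rewrite XopM.
rewrite exchange_big; apply: eq_bigr => p _; apply: eq_bigr => q _.
by rewrite !big_cons !pi_op_tinM.
Qed.

Definition xword (ls : seq L) (f : F) : F := foldr (fun l => x l) f ls.

Lemma pi_op_word_in ls f :
  pi_op x (\prod_(l <- ls) tin l) (tin f) = tin (xword ls f).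
Proof.
elim: ls => [|l ls IH]; first by rewrite big_nil pi_op1.
by rewrite big_cons pi_op_tinM IH Xop_in.
Qed.

Hypothesis hx : forall l, invd (x l).

Lemma x_rtrans l a f : x l (rtrans a f) = rtrans a (x l f).
Proof. by move: a f; apply/invd_rtrans; [exact: linearP | exact: hx]. Qed.

(** This is the right invariance of [X(l)]: on the first letter it is that of [x(l')], on the rest
    it is the induction hypothesis for [X(l'')]. For mismatched lengths both sides vanish, since
    [X(l)] preserves length. *)
Lemma Xop_ttrans l v u : Xop x l (ttrans v u) = ttrans v (Xop x l u).
Proof.
elim/tensor_ind: v u l => [|a v1 v2 IH1 IH2||a v IH] u l.
- by rewrite !(linear_pred0 (ttrans_linearl _)) Xop0.
- by rewrite !ttrans_linearl Xop_is_linearr IH1 IH2.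
- elim/tensor_ind: u => [|b u1 u2 IH1 IH2||f u _].
  + by rewrite (linear_pred0 (ttrans_linearr _)) Xop0
      (linear_pred0 (ttrans_linearr _)).
  + by rewrite ttrans_linearr !Xop_is_linearr IH1 IH2 ttrans_linearr.
  + by rewrite ttrans11 Xop1 (linear_predZ (ttrans_linearr _)) ttrans11.
  + rewrite ttrans1_tinM Xop0 Xop_tinM (linear_pred_sum (ttrans_linearr _)).
    by rewrite big1 // => p _; rewrite ttrans1_tinM.
- elim/tensor_ind: u => [|b u1 u2 IH1 IH2||f u _].
  + by rewrite (linear_pred0 (ttrans_linearr _)) Xop0
      (linear_pred0 (ttrans_linearr _)).
  + by rewrite ttrans_linearr !Xop_is_linearr IH1 IH2 ttrans_linearr.
  + by rewrite ttrans_tinM1 Xop0 Xop1 (linear_predZ (ttrans_linearr _))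
      ttrans_tinM1 scaler0.
  + rewrite ttrans_tinM !Xop_tinM (linear_pred_sum (ttrans_linearr _)).
    by apply: eq_bigr => p _; rewrite ttrans_tinM IH x_rtrans.
Qed.

Lemma pi_op_ttrans w v u : pi_op x w (ttrans v u) = ttrans v (pi_op x w u).
Proof.
elim/tensor_ind: w => [|a w1 w2 IH1 IH2||l w IH].
- by rewrite !(linear_pred0 (pi_op_is_linear x _)) (linear_pred0 (ttrans_linearr _)).
- by rewrite !pi_op_is_linear IH1 IH2 ttrans_linearr.
- by rewrite !pi_op1.
- by rewrite !pi_op_tinM IH Xop_ttrans.
Qed.

(** The pairing of [v] with [\pi_x(w) u] is the counit of a translate, and invariance moves the
    translation onto [u]. *)
Lemma pi_op_eq0 w :
  (forall u, tcounit (pi_op x w u) = 0) -> forall u, pi_op x w u = 0.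
Proof.
move=> w0 u; apply: pairing_nondegr => v.
by rewrite -tcounit_ttrans -pi_op_ttrans.
Qed.

Lemma xword_linear ls : linear (xword ls).
Proof. by elim: ls => [|l ls IH] a f g //=; rewrite IH linearP. Qed.

Lemma xword_invd ls : invd (xword ls).
Proof.
apply/(invd_rtrans (xword_linear ls)) => a f.
by elim: ls => //= l ls ->; rewrite x_rtrans.
Qed.

(** The summand of degree [n] of [Yop]. Starting the recursion at the counit instead of at [n = 1]
    treats all degrees alike; [Yterm1] reconciles both by the counit axiom. *)
Fixpoint Yterm (n : nat) (f : F) : tensor K :=
  if n is n'.+1 then \sum_(p <- coprod f) tin (transp_t x p.2) * Yterm n' p.1
  else (counit f)%:A.

Lemma transp_t_linear : linear (transp_t x).
Proof.
move=> a f g; rewrite /transp_t scaler_sumr -big_split; apply: eq_bigr => i _.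
rewrite /= scalerA -scalerDl; congr (_ *: _).
rewrite !ipair_transp /ipair linearP; exact: counit_linear.
Qed.

Lemma Yterm1 f : Yterm 1 f = tin (transp_t x f).
Proof.
rewrite /= -{2}[f]coprod_counitl (linear_pred_sum transp_t_linear) linear_sum.
apply: eq_bigr => p _.
by rewrite (linear_predZ transp_t_linear) linearZ /= -scalerAr mulr1.
Qed.

(** The index shifts because [coprod_op_iter n] has [n + 1] tensor factors. *)
Lemma tlift_coprod_op n f :
  tlift (tin \o transp_t x) (coprod_op_iter n f) = Yterm n.+1 f.
Proof.
have lin : linear (tin \o transp_t x).
  by move=> a u v; rewrite /= transp_t_linear linearP.
elim: n f => [|n IH] f; first by rewrite Yterm1 /= (tlift_in lin).
rewrite [coprod_op_iter _ _]/= (linear_pred_sum (tlift_is_linear _)).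
by apply: eq_bigr => p _; rewrite (tlift_tinM lin) IH.
Qed.

Lemma Yop_sum m f : Yop x m f = \sum_(n < m.+1) Yterm n f.
Proof.
rewrite /Yop -(big_mkord xpredT (Yterm ^~ f)) big_ltn //; congr (_ + _).
apply: eq_big_nat => -[|n] // _.
exact: tlift_coprod_op.
Qed.

Lemma Yterm_deg n f : tdeg_le n (Yterm n f).
Proof.
elim: n f => [|n IH] f /=.
  rewrite -[_%:A]addr0 -tword_nil.
  by apply: tdeg_leD; [apply: tdeg_le_word | apply: tdeg_le0].
by apply: tdeg_le_sum => p _; apply: tdeg_le_tinM.
Qed.

Lemma Yop_deg m f : tdeg_le m (Yop x m f).
Proof.
rewrite Yop_sum; apply: tdeg_le_sum => n _.
by apply: tdeg_le_leq (@Yterm_deg n f); rewrite -ltnS.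
Qed.

(** By invariance of [g = xword ls], [g f = \sum <g, f'> f'']. Applying [x(l)] and the counit pairs
    the first letter [l] with [y_t(f'')] and leaves [f'] to the other letters, hence the opposite
    coproduct. *)
Lemma pairing_Yterm n f ls :
  pairing (Yterm n f) (\prod_(l <- ls) tin l) =
  if n == size ls then counit (xword ls f) else 0.
Proof.
elim: n ls f => [|n IH] [|l ls] f /=.
- by rewrite big_nil (linear_predZ (pairing_linearl _)) pairing11 [LHS]mulr1.
- by rewrite big_cons (linear_predZ (pairing_linearl _)) pairing1_tinM scaler0.
- rewrite big_nil (linear_pred_sum (pairing_linearl _)) big1 // => p _.
  by rewrite pairing_tinM1.
- rewrite big_cons (linear_pred_sum (pairing_linearl _)) eqSS.
  case: (n =P size ls) => [sz|/eqP/negPf sz]; last first.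
    by rewrite big1 // => p _; rewrite pairing_tinM IH sz mulr0.
  rewrite (invd_ipair (xword_invd ls)) linear_sum.
  rewrite (linear_pred_sum (@counit_linear C E)); apply: eq_bigr => p _.
  rewrite pairing_tinM IH sz eqxx transp_tE ipair_transp linearZ /=.
  by rewrite (linear_predZ (@counit_linear C E)) [LHS]mulrC.
Qed.

Lemma pairing_Yop m f ls : (size ls <= m)%N ->
  pairing (Yop x m f) (\prod_(l <- ls) tin l) =
  tcounit (pi_op x (\prod_(l <- ls) tin l) (tin f)).
Proof.
move=> le; rewrite pi_op_word_in tcounit_in Yop_sum.
rewrite (linear_pred_sum (pairing_linearl _)).
(* Only the degree [size ls] survives, and it occurs because [size ls <= m]. *)
rewrite (bigD1 (Ordinal (le : (size ls < m.+1)%N))) //= pairing_Yterm eqxx.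
by rewrite big1 ?addr0 // => i; rewrite -val_eqE pairing_Yterm => /negPf /= ->.
Qed.

End Transpose.

(** * The unit of [T_m(K)] *)

Lemma dprod_one_deg (C : fieldType) (K : falgType C) m :
  tdeg_le m (dprod_one K m).
Proof.
apply: tdeg_le_sum => n _.
have -> : tin 1 ^+ n = \prod_(v <- nseq n 1) tin v :> tensor K.
  by rewrite big_nseq; elim: (nat_of_ord n) => //= k <-; rewrite exprS.
by apply: tdeg_le_prod; rewrite size_nseq -ltnS.
Qed.

(** The unit of a dual algebra is the counit of the coalgebra, here that of [T(L)], multiplicative
    on words. *)
Lemma pairing_dprod_one (C : fieldType) (K : falgType C) m (ls : seq (dual K)) :
  (size ls <= m)%N ->
  pairing (dprod_one K m) (\prod_(l <- ls) tin l) = \prod_(l <- ls) counit l.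
Proof.
move=> le; rewrite (linear_pred_sum (pairing_linearl _)).
have one_n n : pairing (tin 1 ^+ n) (\prod_(l <- ls) tin l) =
    if n == size ls then \prod_(l <- ls) counit l else 0.
  elim: n ls {le} => [|n IH] [|l ls]; rewrite ?big_nil ?big_cons ?exprS ?expr0.
  - exact: pairing11.
  - exact: pairing1_tinM.
  - exact: pairing_tinM1.
  - by rewrite pairing_tinM IH eqSS; case: eqP; rewrite ?mulr0.
rewrite (bigD1 (Ordinal (le : (size ls < m.+1)%N))) //= one_n eqxx.
by rewrite [X in _ + X]big1 ?addr0 // => i; rewrite -val_eqE one_n => /negPf /= ->.
Qed.

(** * Separating a point from a subspace in finite dimension *)

Lemma subspace_row_span (C : fieldType) n (S : set 'rV[C]_n) :
    S 0 -> (forall a u v, S u -> S v -> S (a *: u + v)) ->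
  exists M : 'M[C]_n, forall v, (v <= M)%MS <-> S v.
Proof.
move=> S0 Slin.
(* Among the matrices with row space inside [S], one of maximal rank works: a vector of [S] outside
   its row space would raise the rank. *)
pose P r := `[< exists2 M : 'M[C]_n, \rank M = r & forall v, (v <= M)%MS -> S v >].
have P0 : exists r, P r.
  exists 0%N; apply/asboolP; exists 0; first exact: mxrank0.
  by move=> v; rewrite submx0 => /eqP ->.
have Pn r : P r -> (r <= n)%N by move/asboolP=> [M <- _]; apply: rank_leq_row.
case: (ex_maxnP P0 Pn) => r /asboolP[M Mr MS] max_r.
exists M => v; split=> [|Sv]; first exact: MS.
have : P (\rank (M + v)%MS).
  apply/asboolP; exists (M + v)%MS => // w /sub_addsmxP[[a b] /= ->].
  rewrite addrC [b]mx11_scalar mul_scalar_mx.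
  by apply: Slin => //; apply: MS; apply: submxMl.
move=> /max_r; rewrite -Mr => le_r.
apply: submx_trans (addsmxSr M v) _.
by rewrite -(geq_leqif (mxrank_leqif_sup (addsmxSl M v))).
Qed.

(** The row space of [M] is the common kernel of the columns of [cokermx M], so one of these columns
    is nonzero on [u]. *)
Lemma separating_column (C : fieldType) n (S : set 'rV[C]_n) u :
    S 0 -> (forall a v w, S v -> S w -> S (a *: v + w)) -> ~ S u ->
  exists2 c : 'cV[C]_n, (forall v, S v -> v *m c = 0) & u *m c != 0.
Proof.
move=> S0 Slin Su; have [M MS] := subspace_row_span S0 Slin.
have : u *m cokermx M != 0 by rewrite -submxE; apply/negP => /MS.
case/rV0Pn => j uj; exists (col j (cokermx M)) => [v /MS|].
  by rewrite submxE => /eqP vM; rewrite colE mulmxA vM mul0mx.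
apply: contra uj; rewrite colE mulmxA -colE => /eqP/colP/(_ 0).
by rewrite !mxE => ->.
Qed.

Section Separation.
Variables (C : fieldType) (K : falgType C).

Lemma pairing_dual_basis s (u : tensor K) :
  pairing u (\prod_(i <- s) tin (dual_basis i)) = u@_(FMonom s).
Proof.
elim/tensor_word_ind: u => [|a u v IHu IHv|t].
- by rewrite (linear_pred0 (pairing_linearl _)) mcoeff0.
- by rewrite pairing_linearl IHu IHv mcoeffD mcoeffZ.
have := pairing_prod (map (@tbasis _ _) t) (map (@dual_basis _ K) s).
rewrite !big_map -tword_prod !size_map => ->.
have -> : (tword t : tensor K)@_(FMonom s) = (t == s)%:R.
  by rewrite /tword mcoeffU1.
elim: s t => [|i s IHs] [|j t] /=; rewrite ?big_nil ?eqSS ?eqseq_cons //.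
rewrite big_cons /= lfunE /= coord_tbasis; case: (j =P i) => [_|] /=.
  by rewrite mul1r IHs.
by move=> _; rewrite mul0r if_same.
Qed.

Lemma pairing_separates m (B : set (tensor K)) u :
    B `<=` tdeg_le m -> B 0 ->
    (forall a v w, B v -> B w -> B (a *: v + w)) -> tdeg_le m u -> ~ B u ->
  exists w : tensor (dual K),
    [/\ tdeg_le m w, forall v, B v -> pairing v w = 0 & pairing u w != 0].
Proof.
move=> Bm B0 Blin um Bu.
(* The finite type of words of length at most [m]. The coordinates [enc] are injective on [T_m(K)]
   because coefficients on longer words are 0 there. *)
pose I := {bseq m of 'I_(\dim {:K})}.
pose enc (v : tensor K) : 'rV[C]_#|I| := \row_j v@_(FMonom (enum_val j : I)).
have enc_lin a v w : enc (a *: v + w) = a *: enc v + enc w.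
  by apply/rowP => j; rewrite !mxE mcoeffD mcoeffZ.
have enc_inj v w : tdeg_le m v -> tdeg_le m w -> enc v = enc w -> v = w.
  move=> vm wm e; apply/malgP => -[s]; case: (leqP (size s) m) => sm.
    have := congr1 (fun A : 'rV_#|I| => A 0 (enum_rank (Bseq sm : I))) e.
    by rewrite !mxE enum_rankK.
  have out t : tdeg_le m t -> t@_(FMonom s) = 0.
    by move=> tm; apply: mcoeff_outdom; apply/negP => /tm; rewrite /= leqNgt sm.
  by rewrite !out.
pose S : set 'rV[C]_#|I| := [set enc v | v in B].
have [|||c Sc uc] := @separating_column C _ S (enc u).
- exists 0 => //; apply/rowP => j; rewrite !mxE; exact: mcoeff0.
- move=> a _ _ [v Bv <-] [w Bw <-]; exists (a *: v + w); first exact: Blin.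
  exact: enc_lin.
- by case=> v Bv /(enc_inj _ _ (Bm _ Bv) um) vu; apply: Bu; rewrite -vu.
(* Words in the dual basis read off coordinates, so taking [c] as coefficients makes the pairing
   with [w] equal to multiplication by [c]. *)
pose w : tensor (dual K) :=
  \sum_j c j 0 *: \prod_(i <- (enum_val j : I)) tin (dual_basis i).
have pw v : pairing v w = (enc v *m c) 0 0.
  rewrite mxE (linear_pred_sum (pairing_linearr v)); apply: eq_bigr => j _.
  rewrite (linear_predZ (pairing_linearr v)) mxE.
  by rewrite -(pairing_dual_basis (enum_val j : I)) [LHS]mulrC.
exists w; split=> [|v Bv|].
- apply: tdeg_le_sum => j _; rewrite -[_ *: _]addr0.
  apply: tdeg_leD; last exact: tdeg_le0.
  rewrite -(big_map (@dual_basis _ K) xpredT (fun l => tin l)).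
  by apply: tdeg_le_prod; rewrite size_map size_bseq.
- by rewrite pw Sc ?mxE //; exists v.
- apply: contra uc => /eqP; rewrite pw => uc0; apply/eqP/matrixP => i j.
  by rewrite !ord1 uc0 mxE.
Qed.

End Separation.

(** * The functionals [e_t] and the two orthogonality statements *)

Section Relations.
Variables (C : fieldType) (K E : falgType C).
Variable x : 'Hom(dual K, 'End(dual E)).
Hypothesis hx : forall l : dual K, invd (x l).
Variable m : nat.
Notation word ls := (\prod_(l <- ls) tin l).

(** On [T_m(L)], [u] is the functional [e_t]. The test words have arbitrary letters of [L], not only
    basis elements, as do the legs of [words_coprod]. *)
Let represents (u : tensor K) (t : tensor (dual E)) :=
  forall ls : seq (dual K), (size ls <= m)%N ->
    pairing u (word ls) = tcounit (pi_op x (word ls) t).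

Lemma represents_one : represents (dprod_one K m) 1.
Proof.
move=> ls le; rewrite pairing_dprod_one //.
elim: ls {le} => [|l ls IH]; first by rewrite !big_nil pi_op1 tcounit1.
have -> : forall ls', pi_op x (word ls') 1 = (\prod_(l <- ls') counit l)%:A.
  elim=> [|l' ls' IH']; first by rewrite !big_nil pi_op1 scale1r.
  rewrite !big_cons pi_op_tinM IH' (linear_predZ (Xop_is_linearr x l')) Xop1.
  by rewrite scalerA mulrC.
by rewrite (linear_predZ (@tcounit_linear C E)) tcounit1 [RHS]mulr1.
Qed.

Lemma represents_Yop f : represents (Yop x m f) (tin f).
Proof. by move=> ls; apply: pairing_Yop. Qed.

Lemma represents0 : represents 0 0.
Proof.
move=> ls _; rewrite (linear_pred0 (pairing_linearl _)).
by rewrite (linear_pred0 (pi_op_linearr x _)) tcounit0.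
Qed.

Lemma represents_lin a u v t s :
  represents u t -> represents v s -> represents (a *: u + v) (a *: t + s).
Proof.
move=> ut vs ls le; rewrite pairing_linearl ut // vs //.
by rewrite pi_op_linearr tcounit_linear.
Qed.

(** Both sides expand along [words_coprod ls], whose legs are as long as [ls], so the hypotheses
    apply to them. *)
Lemma represents_mul u v t s :
  represents u t -> represents v s -> represents (dprod_mul u v) (t * s).
Proof.
move=> ut vs ls le; rewrite pairing_dprod_mul pi_op_words_mul.
rewrite (linear_pred_sum (@tcounit_linear C E)) big_seq [RHS]big_seq.
apply: eq_bigr => q /size_words_coprod q_size.
by rewrite tcounitM ut ?vs // q_size.
Qed.

Lemma dprod_mul_deg (u v : tensor K) :
  tdeg_le m u -> tdeg_le m v -> tdeg_le m (dprod_mul u v).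
Proof.
move=> um vm; move: u um; apply: tdeg_le_ind => [|a u1 u2 IH1 IH2|s sm].
- by rewrite (linear_pred0 (dprod_mul_linearl _)); apply: tdeg_le0.
- by rewrite dprod_mul_linearl; apply: tdeg_leD.
move: v vm; apply: tdeg_le_ind => [|a u1 u2 IH1 IH2|t tm].
- by rewrite (linear_pred0 (dprod_mul_linearr _)); apply: tdeg_le0.
- by rewrite dprod_mul_linearr; apply: tdeg_leD.
have := dprod_mul_prod (map (@tbasis _ _) s) (map (@tbasis _ _) t).
rewrite !big_map -!tword_prod !size_map => ->.
case: eqP => [e|_]; last exact: tdeg_le0.
rewrite -(big_map (fun p => p.1 * p.2) xpredT (fun v => tin v)).
by apply: tdeg_le_prod; rewrite size_map size_zip !size_map e minnn.
Qed.

Let representable : set (tensor K) :=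
  [set u | tdeg_le m u /\ exists t, represents u t].

Lemma representable_subalg : dprod_subalg m representable.
Proof.
split=> [u [] //||a u v [um [t ut]] [vm [s vs]]|u v [um [t ut]] [vm [s vs]]].
- by split; [apply: tdeg_le0 | exists 0; apply: represents0].
- by split; [apply: tdeg_leD | exists (a *: t + s); apply: represents_lin].
- by split; [apply: dprod_mul_deg | exists (t * s); apply: represents_mul].
Qed.

(** The generators represent [1] and the elements of [F], so minimality of [Bsup] applies. *)
Lemma Bsup_representable : Bsup x m `<=` representable.
Proof.
apply: smallest_sub; first exact: representable_subalg.
move=> u [-> | [f _ <-]]; split.
- exact: dprod_one_deg.
- by exists 1; apply: represents_one.
- exact: Yop_deg.
- by exists (tin f); apply: represents_Yop.
Qed.

(** An intersection of subalgebras is one; the degree bound, which an empty intersection would lack,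
    comes from [representable]. *)
Lemma Bsup_subalg : dprod_subalg m (Bsup x m).
Proof.
split=> [u /Bsup_representable[] //||a u v Bu Bv|u v Bu Bv].
- by move=> A [[_ A0 _ _] _].
- by move=> A [Asub Agen]; case: (Asub) => _ _ Alin _; apply: Alin;
    [apply: Bu | apply: Bv].
- by move=> A [Asub Agen]; case: (Asub) => _ _ _ Amul; apply: Amul;
    [apply: Bu | apply: Bv].
Qed.

(** [F] generates [T(F)], and each operation of [T(F)] is matched by one under which [Bsup x m] is
    closed. *)
Lemma represented_in_Bsup t : exists2 u, Bsup x m u & represents u t.
Proof.
have [_ B0 Blin Bmul] := Bsup_subalg.
have Bgen : [set dprod_one K m] `|` range (Yop x m) `<=` Bsup x m.
  exact: sub_gen_smallest.
elim/tensor_ind: t => [|a t1 t2 [u1 B1 r1] [u2 B2 r2]||f t [u Bu r]].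
- by exists 0 => //; apply: represents0.
- by exists (a *: u1 + u2); [apply: Blin | apply: represents_lin].
- by exists (dprod_one K m); [apply: Bgen; left | apply: represents_one].
- exists (dprod_mul (Yop x m f) u).
    by apply: Bmul => //; apply: Bgen; right; exists f.
  by apply: represents_mul => //; apply: represents_Yop.
Qed.

Lemma represents_pairing u t w :
  represents u t -> tdeg_le m w -> pairing u w = tcounit (pi_op x w t).
Proof.
move=> ut; move: w; apply: tdeg_le_ind => [|a w1 w2 IH1 IH2|s sm].
- rewrite (linear_pred0 (pairing_linearr _)) (linear_pred0 (pi_op_is_linear x _)).
  by rewrite tcounit0.
- by rewrite pairing_linearr pi_op_is_linear tcounit_linear IH1 IH2.
- rewrite tword_prod -(big_map (@tbasis _ _) xpredT (fun l => tin l)).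
  by apply: ut; rewrite size_map.
Qed.

(** Orthogonality of [w] to [B^m] says that [\epsilon(\pi_x(w) t) = 0] for all [t], which by
    [pi_op_eq0] forces [\pi_x(w) = 0]. *)
Lemma orthL_Bsup : orthL m (Bsup x m) = relations x m.
Proof.
apply/seteqP; split=> w [wm w0]; split=> // u.
- move: u; apply: (pi_op_eq0 hx) => t; have [u Bu ut] := represented_in_Bsup t.
  by rewrite -(represents_pairing ut wm); apply: w0.
- move=> /Bsup_representable[_ [t ut]].
  by rewrite (represents_pairing ut wm) w0 tcounit0.
Qed.

Lemma Bsub_Bsup : Bsub x m = Bsup x m.
Proof.
have [Bm B0 Blin _] := Bsup_subalg.
apply/seteqP; split=> u; last first.
  move=> Bu; split=> [|w]; first exact: Bm.
  by rewrite -orthL_Bsup => -[_]; apply.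
(* Were [u] outside [B^m], some [w] orthogonal to [B^m] would be nonzero on [u]; but such a [w] is a
   relation. *)
case=> um u0; apply: contrapT => /(pairing_separates Bm B0 Blin um)[w [wm w0]].
by rewrite u0 ?eqxx // -orthL_Bsup.
Qed.

End Relations.

Local Open Scope complex_scope.

Theorem mainTheorem6 (R : realType) (K E : falgType R[i])
    (x : 'Hom(dual K, 'End(dual E))) (hx : forall l : dual K, invd (x l))
    (m : nat) :
  orthL m (Bsup x m) = relations x m /\ Bsub x m = Bsup x m.
Proof. by split; [apply: orthL_Bsup | apply: Bsub_Bsup]. Qed.
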